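(* Let $f$ be an nc function on an admissible nc set $\Omega\subseteq\mathbb{C}^g_{\rm nc}$, let $S$ be a finite collection of semisimple points in $\Omega$, and let $L\in\mathbb{N}$. Then there exists a noncommutative polynomial $p\in\mathbb{C}\langle x_1,\dots,x_g\rangle$ such that $f$ and $p$ agree on $S$ up to their noncommutative differentials of order $L$, that is, $\Delta^\ell_Yf=\Delta^\ell_Yp$ for all $Y\in S$ and $0\le\ell\le L$.
   Context: Let $\mathbb{C}^g_{\rm nc}=\bigsqcup_{n\in\mathbb{N}}M_n(\mathbb{C})^g$; direct sums and conjugations of tuples are taken componentwise. A subset $\Omega\subseteq\mathbb{C}^g_{\rm nc}$ is an nc set if it is closed under direct sums; $\Omega_n=\Omega\cap M_n(\mathbb{C})^g$. An nc function $f:\Omega\to\bigsqcup_n M_n(\mathbb{C})$ satisfies $f(\Omega_n)\subseteq M_n(\mathbb{C})$, $f(X\oplus X')=f(X)\oplus f(X')$, and $f(SXS^{-1})=Sf(X)S^{-1}$ whenever $X,SXS^{-1}\in\Omega_n$, $S\in GL_n(\mathbb{C})$. An nc set $\Omega$ is (right) admissible if for all $X\in\Omega_m$, $Y\in\Omega_n$ and $Z\in(\mathbb{C}^{m\times n})^g$ there is $\alpha\in\mathbb{C}\setminus\{0\}$ with $\begin{pmatrix}X&\alpha Z\\0&Y\end{pmatrix}\in\Omega_{m+n}$. For an nc function $f$ on an admissible nc set $\Omega$, $Y\in\Omega_s$ and $\ell\in\mathbb{N}$, the $\ell$-th order nc differential operator at $Y$ is the $\ell$-linear map $\Delta^\ell_Yf:(M_s(\mathbb{C})^g)^\ell\to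 M_s(\mathbb{C})$ determined by $$f\begin{pmatrix}Y&Z^1&&\\&\ddots&\ddots&\\&&\ddots&Z^\ell\\&&&Y\end{pmatrix}=\begin{pmatrix}f(Y)&\Delta^1_Yf(Z^1)&\cdots&\Delta^\ell_Yf(Z^1,\dots,Z^\ell)\\&\ddots&\ddots&\vdots\\&&\ddots&\Delta^1_Yf(Z^\ell)\\&&&f(Y)\end{pmatrix}$$ (whenever the block upper bidiagonal point on the left lies in $\Omega$; it is extended to all arguments by multilinearity). Set $\Delta^0_Yf=f(Y)$. Noncommutative polynomials are nc functions on all of $\mathbb{C}^g_{\rm nc}$. A point $Y\in M_s(\mathbb{C})^g$ is semisimple if every subspace of $\mathbb{C}^s$ invariant under $Y_1,\dots,Y_g$ admits a complementary invariant subspace. *)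

(* Defs.v *)
From HB Require Import structures.
From mathcomp Require Import all_boot all_order all_algebra.
From mathcomp Require Import boolp classical_sets cardinality reals.
From mathcomp Require Import complex.
From mathcomp Require Import finmap monalg.
From mathcomp Require Import ring.

Set Implicit Arguments.
Unset Strict Implicit.
Unset Printing Implicit Defensive.

Import GRing.Theory.
Local Open Scope ring_scope.

(* Level 0 is allowed: a noncommutative space with positive levels only is the
   case of sets Omega that contain no point of size 0. *)
Definition nctuple (C : fieldType) (g n : nat) := {ffun 'I_g -> 'M[C]_n}.

Definition ncspace (C : fieldType) (g : nat) := {n : nat & nctuple C g n}.

Definition ncpt (C : fieldType) (g n : nat) (X : nctuple C g n) : ncspace C g :=
  existT _ n X.

Section NC.
Variables (C : fieldType) (g : nat).
Implicit Types (Omega : set (ncspace C g)) (f : forall n, nctuple C g n -> 'M[C]_n).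

Definition ncblock m n (X : nctuple C g m) (Z : 'I_g -> 'M[C]_(m, n))
    (Y : nctuple C g n) : nctuple C g (m + n) :=
  [ffun i => block_mx (X i) (Z i) 0 (Y i)].

Definition ncdsum m n (X : nctuple C g m) (Y : nctuple C g n) :=
  ncblock X (fun=> 0) Y.

Definition ncconj n (S : 'M[C]_n) (X : nctuple C g n) : nctuple C g n :=
  [ffun i => S *m X i *m invmx S].

Definition nc_set Omega : Prop :=
  forall m n (X : nctuple C g m) (Y : nctuple C g n),
    Omega (ncpt X) -> Omega (ncpt Y) -> Omega (ncpt (ncdsum X Y)).

Definition admissible Omega : Prop :=
  forall m n (X : nctuple C g m) (Y : nctuple C g n) (Z : 'I_g -> 'M[C]_(m, n)),
    Omega (ncpt X) -> Omega (ncpt Y) ->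
    exists2 a : C, a != 0 & Omega (ncpt (ncblock X (fun i => a *: Z i) Y)).

(* Only the values of f on Omega are constrained. *)
Definition nc_function Omega f : Prop :=
  (forall m n (X : nctuple C g m) (Y : nctuple C g n),
     Omega (ncpt X) -> Omega (ncpt Y) ->
     f _ (ncdsum X Y) = block_mx (f m X) 0 0 (f n Y))
  /\
  (forall n (X : nctuple C g n) (S : 'M[C]_n),
     S \in unitmx -> Omega (ncpt X) -> Omega (ncpt (ncconj S X)) ->
     f n (ncconj S X) = S *m f n X *m invmx S).

(* The (l+1)-by-(l+1) block matrix with Y on the diagonal and
   Z ord0, ..., Z ord_max on the superdiagonal: block column k.+1 carries Z k
   in block row k. *)
Definition ncbidiag s (Y : nctuple C g s) l (Z : 'I_l -> nctuple C g s) :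
    nctuple C g (\sum_(i < l.+1) s) :=
  [ffun h => \mxblock_(i < l.+1, j < l.+1)
     (if i == j then Y h
      else if unlift ord0 j is Some k then
        if i == k :> nat then Z k h else 0
      else 0)].

(* The l-th order differential at Y: the top right block of f at the bidiagonal
   point. When (Y; Z) itself lies outside Omega, multilinearity leaves a single
   possibility: rescale each Z k by a nonzero a k so as to enter Omega
   (admissibility provides such scalars), and divide the block obtained by the
   product of the a k. On nc functions the result does not depend on a
   (ncdiff_uniq), is the block itself when (Y; Z) is in Omega (ncdiffE), and is
   f Y when l = 0 (ncdiff0). *)
Definition ncdiff Omega f s (Y : nctuple C g s) l
    (Z : 'I_l -> nctuple C g s) : 'M[C]_s :=
  xget 0 [set D | exists a : 'I_l -> C,
    let P := ncbidiag Y (fun k => [ffun h => a k *: Z k h]) in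
    [/\ forall k, a k != 0,
        Omega (ncpt P) &
        D = (\prod_k a k)^-1 *: submxblock (f _ P) ord0 ord_max]].

Definition ncpoly := {malg C[{fmonom 'I_g}]}.

Definition nceval (p : ncpoly) n (X : nctuple C g n) : 'M[C]_n :=
  \sum_(w <- msupp p) p@_w *: \big[mulmx/1%:M]_(i <- (w : seq 'I_g)) X i.

Definition invariant s (Y : nctuple C g s) (U : {vspace 'cV[C]_s}) : Prop :=
  forall (i : 'I_g) (v : 'cV[C]_s), v \in U -> Y i *m v \in U.

Definition semisimple s (Y : nctuple C g s) : Prop :=
  forall U : {vspace 'cV[C]_s}, invariant Y U ->
    exists W : {vspace 'cV[C]_s},
      [/\ invariant Y W, (U + W)%VS = fullv & (U :&: W)%VS = 0%VS].

End NC.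

Section NCDiffTheory.
Variables (C : fieldType) (g : nat).
Variables (Omega : set (ncspace C g)) (f : forall n, nctuple C g n -> 'M[C]_n).
Hypothesis f_nc : nc_function Omega f.
Variables (s : nat) (Y : nctuple C g s).

Let rescale l (a : 'I_l -> C) (Z : 'I_l -> nctuple C g s) (k : 'I_l) :
  nctuple C g s := [ffun h => a k *: Z k h].

Lemma ncdiff_uniq l (Z : 'I_l -> nctuple C g s) (a b : 'I_l -> C) :
  let P c := ncbidiag Y (rescale c Z) in
  (forall k, a k != 0) -> (forall k, b k != 0) ->
  Omega (ncpt (P a)) -> Omega (ncpt (P b)) ->
  (\prod_k a k)^-1 *: submxblock (f (P a)) ord0 ord_max =
  (\prod_k b k)^-1 *: submxblock (f (P b)) ord0 ord_max.
Proof.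
move=> P a0 b0 Pa Pb.
pose d (i : 'I_l.+1) := \prod_(k < l | (k < i)%N) (a k / b k).
have d0 i : d i != 0.
  by apply/prodf_neq0 => k _; rewrite mulf_neq0 ?invr_neq0.
have dS (k : 'I_l) (i : 'I_l.+1) : i = k :> nat ->
    d (lift ord0 k) = a k / b k * d i.
  move=> ik; rewrite /d (bigD1 k) //=; congr (_ * _).
  apply: eq_bigl => m; rewrite /= /bump leq0n add1n ltnS ik ltn_neqAle.
  by rewrite andbC.
pose D := \mxdiag_(i < l.+1) ((d i)%:M : 'M[C]_s).
pose D' := \mxdiag_(i < l.+1) ((d i)^-1%:M : 'M[C]_s).
have DD' : D *m D' = 1%:M.
  rewrite /D' /mxdiag mul_mxdiag_mxblock -(mxdiagZ _ (p_ := fun=> s)) /mxdiag.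
  apply/eq_mxblock => i j. 
  case: (eqVneq i j) => [_|_]; last by rewrite mulmx0.
  by rewrite !conform_mx_id -scalar_mxM divff.
have Du : D \in unitmx by case/mulmx1_unit: DD'.
have iD : invmx D = D' by rewrite -[LHS]mulmx1 -DD' mulKmx.
have PbE : P b = ncconj D (P a).
  apply/ffunP => h; rewrite !ffunE iD mul_mxdiag_mxblock mul_mxblock_mxdiag.
  apply/eq_mxblock => i j.
  rewrite mul_scalar_mx mul_mx_scalar scalerA.
  case: eqVneq => [->|_]; first by rewrite mulVf ?scale1r.
  case: unliftP => [k jk|_]; last by rewrite scaler0.
  case: eqP => [ik|_]; last by rewrite scaler0.
  rewrite !ffunE scalerA jk (dS k i ik); congr (_ *: _).
  by field; rewrite d0 a0 b0.
rewrite PbE (f_nc.2 _ _ _ Du Pa) -?PbE // iD.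
rewrite -[f (P a) in RHS]submxblockK mul_mxdiag_mxblock mul_mxblock_mxdiag.
rewrite mxblockK mul_scalar_mx mul_mx_scalar !scalerA; congr (_ *: _).
have -> : d ord0 = 1 by rewrite /d big_pred0.
have -> : d ord_max = (\prod_k a k) / (\prod_k b k).
  by rewrite /d -prodf_div; apply: eq_bigl => k /=; rewrite ltn_ord.
have ? : \prod_k a k != 0 by apply/prodf_neq0.
have ? : \prod_k b k != 0 by apply/prodf_neq0.
by field; apply/andP.
Qed.

Lemma ncdiffE l (Z : 'I_l -> nctuple C g s) :
  Omega (ncpt (ncbidiag Y Z)) ->
  ncdiff Omega f Y Z = submxblock (f (ncbidiag Y Z)) ord0 ord_max.
Proof.
move=> OZ; have Z1 : rescale (fun=> 1) Z = Z.
  by apply/funext => k; apply/ffunP => h; rewrite ffunE scale1r.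
apply: xget_unique => [|_ [a [a0 Pa ->]]].
  exists (fun=> 1) => /=; rewrite [X in ncbidiag Y X]Z1.
  by split=> // [_|]; rewrite ?oner_neq0 // big1_eq invr1 scale1r.
have := @ncdiff_uniq l Z a (fun=> 1) a0 (fun=> oner_neq0 _) Pa.
by rewrite Z1 big1_eq invr1 scale1r; apply.
Qed.

Lemma ncdiff0 (Z : 'I_0 -> nctuple C g s) :
  Omega (ncpt Y) -> ncdiff Omega f Y Z = f Y.
Proof.
move=> OY.
have e : s = (\sum_(i < 1) s)%N by rewrite big_ord1.
have blockE (A : 'M[C]_s) : castmx (e, e) A = \mxblock_(i < 1, j < 1) A.
  by rewrite {1}(mxEmxblock A) castmx_comp castmx_id.
have castE n (E : s = n) (X : nctuple C g n) :
    (forall h, X h = castmx (E, E) (Y h)) ->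
    Omega (ncpt X) /\ f X = castmx (E, E) (f Y).
  case: n / E X => X XY; suff -> : X = Y by rewrite castmx_id.
  by apply/ffunP => h; rewrite XY castmx_id.
have [h|OB fB] := castE _ e (ncbidiag Y Z).
  by rewrite ffunE blockE; apply/eq_mxblock => i j; rewrite !ord1.
by rewrite ncdiffE // fB blockE mxblockK.
Qed.
End NCDiffTheory.

(* Main.v *)
Require Import Defs.
From mathcomp Require Import all_boot all_order all_algebra.
From mathcomp Require Import boolp classical_sets cardinality reals.
From mathcomp Require Import complex.
From mathcomp Require Import finmap monalg.

Set Implicit Arguments.
Unset Strict Implicit.
Unset Printing Implicit Defensive.

Import GRing.Theory.
Local Open Scope classical_set_scope.
Local Open Scope ring_scope.

(** Read a tuple X of n-by-n matrices as the module C^n over the free algebra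
    C<x_1, ..., x_g>, the variables acting by the entries of X. A matrix T with
    T X_h = Y_h T for all h is then a homomorphism from X to Y, and block upper
    triangular tuples are module extensions. Everything below holds over an
    arbitrary field.

    An nc function f commutes with all homomorphisms between points of Omega
    ([nc_function_hom]): T is a homomorphism from X to Y exactly when the shear
    by T fixes the direct sum of Y and X under conjugation. For f to agree with
    a polynomial at one point G, it has to respect submodules as well. It does
    so at the points that are called hereditary here: every submodule V of such
    a point is a retract of some point N of Omega. The retraction of
    N onto V, followed by the inclusion of V in G, is a homomorphism between
    points of Omega, so f(G) maps V into itself. Hereditary points are closed
    under direct sums, and the cyclic submodule generated by the vector
    (e_1, ..., e_n) of the direct sum of n copies of G gives a polynomial p
    with f(G) e_b = p(G) e_b for all b at once, that is f(G) = p(G)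
    ([nc_function_nceval_at]).

    Semisimple points of Omega are hereditary, their submodules being direct
    summands ([hereditary_semisimple]). Hereditary points are closed under
    extensions ([hereditary_ext]): a submodule of an extension is itself an
    extension of a submodule by a submodule, and an extension of retracts is a
    retract of an extension, which admissibility moves into Omega.

    A bidiagonal point over Y is an iterated extension of copies of Y. To get a
    single p for all directions Z, note that the extensions of a given
    module by Y form a finite-dimensional family, so that finitely many
    extension steps build one hereditary point having all of them as quotients
    ([universal_extension]). Iterating L times, and summing over the points of
    S, gives a hereditary point G with every bidiagonal point of order at most L
    over S as a quotient ([universal_bidiag_seq]). A polynomial that agrees with
    f at G agrees with f at every quotient of G lying in Omega, in
    particular at the bidiagonal points that define the differentials of f. *)

(** * Linear algebra *)

Section LinearAlgebra.
Variable C : fieldType.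

Lemma rank_factorization m n (A : 'M[C]_(m, n)) :
  exists r (B : 'M[C]_(m, r)) (D : 'M[C]_(r, n)) (B' : 'M[C]_(r, m))
         (D' : 'M[C]_(n, r)),
    [/\ A = B *m D, B' *m B = 1%:M & D *m D' = 1%:M].
Proof.
exists (\rank A), (col_base A), (row_base A), (pinvmx (col_base A)),
  (pinvmx (row_base A)).
by rewrite mulmx_base mulVpmx ?col_base_full // mulmxVp ?row_base_free.
Qed.

Lemma idempotent_splitting n (A : 'M[C]_n) : A *m A = A ->
  exists r (B : 'M[C]_(n, r)) (D : 'M[C]_(r, n)),
    A = B *m D /\ D *m B = 1%:M.
Proof.
move=> AA; have [r [B [D [B' [D' [AE B'B DD']]]]]] := rank_factorization A.
exists r, B, D; split=> //.
have : B' *m (A *m A) *m D' = B' *m A *m D' by rewrite AA.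
by rewrite AE !mulmxA B'B !mul1mx -!mulmxA DD' !mulmx1.
Qed.

(** The columns of B form a basis, with coordinate map B': take a matrix of
    maximal rank among those with image inside P. Appending a vector of P to it
    leaves the rank unchanged. *)
Lemma subspace_basis n (P : 'cV[C]_n -> Prop) :
  P 0 -> (forall u v, P u -> P v -> P (u + v)) ->
  (forall a v, P v -> P (a *: v)) ->
  exists m (B : 'M[C]_(n, m)) (B' : 'M[C]_(m, n)),
    B' *m B = 1%:M /\ forall v, P v <-> v = B *m (B' *m v).
Proof.
move=> P0 PD PZ.
pose Q r := `[< exists m (A : 'M[C]_(n, m)),
  (forall y, P (A *m y)) /\ \rank A = r >].
have Q0 : exists r, Q r.
  exists 0; apply/asboolP; exists 0, 0; rewrite mxrank0.
  by split=> // y; rewrite mul0mx.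
have Qn r : Q r -> (r <= n)%N.
  by move=> /asboolP[m [A [_ <-]]]; apply: rank_leq_row.
case: (ex_maxnP Q0 Qn) => r /asboolP[m [A [PA rA]]] rmax.
have [k [B [D [B' [D' [AE B'B DD']]]]]] := rank_factorization A.
have PB y : P (B *m y).
  by have := PA (D' *m y); rewrite AE mulmxA -(mulmxA B) DD' mulmx1.
exists k, B, B'; split=> // v; split=> [Pv|->]; last exact: PB.
suff [y ->] : exists y, v = A *m y.
  by rewrite AE !mulmxA -(mulmxA B B') B'B mulmx1.
have rv : (\rank (row_mx A v) <= \rank A)%N.
  rewrite rA; apply: rmax; apply/asboolP.
  exists (m + 1)%N, (row_mx A v); split=> // y.
  rewrite -[y]vsubmxK mul_row_col; apply: PD => //.
  by rewrite [dsubmx y]mx11_scalar mul_mx_scalar; apply: PZ.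
have : (v^T <= A^T)%MS.
  have sA : (A^T <= (row_mx A v)^T)%MS.
    by rewrite tr_row_mx; apply/submxP; exists (row_mx 1%:M 0);
      rewrite mul_row_col mul1mx mul0mx addr0.
  rewrite -mxrank_tr -(mxrank_tr A) in rv.
  have := mxrank_leqif_sup sA; move=> [_ /esym].
  rewrite eqn_leq rv mxrankS // => /submxP[E].
  rewrite tr_row_mx => EE; apply/submxP; exists (dsubmx E).
  by rewrite -{1}[E]vsubmxK mul_col_mx in EE; case/eq_col_mx: EE.
move=> /submxP[E vE]; exists E^T.
by rewrite -[LHS]trmxK vE trmx_mul trmxK.
Qed.

Lemma mulmx_ext m n (A B : 'M[C]_(m, n)) :
  (forall v : 'cV[C]_n, A *m v = B *m v) -> A = B.
Proof.
move=> AB; apply/matrixP => a b.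
by have /matrixP/(_ a 0) := AB (delta_mx b 0); rewrite -!colE !mxE.
Qed.

(** Modules are spaces of column vectors here, whereas [lin1_mx] represents a
    linear map by a matrix acting on row vectors. *)
Lemma linear_colmx m n (f : {linear 'cV[C]_n -> 'cV[C]_m}) :
  exists P : 'M[C]_(m, n), forall v, P *m v = f v.
Proof.
exists (\matrix_(a, b) f (delta_mx b 0) a 0) => v.
rewrite [in RHS](matrix_sum_delta v) linear_sum; apply/matrixP => a b.
rewrite mxE summxE; apply: eq_bigr => c _.
by rewrite big_ord1 linearZ !mxE mulrC ord1.
Qed.

End LinearAlgebra.

Section Interpolation.
Variables (C : fieldType) (g : nat).

(** * Noncommutative polynomials and module homomorphisms *)

Implicit Types (p q : ncpoly C g).

Definition ncword n (X : nctuple C g n) (w : seq 'I_g) : 'M[C]_n :=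
  \big[mulmx/1%:M]_(i <- w) X i.

Lemma nceval_supp (d : {fset {fmonom 'I_g}}) p n (X : nctuple C g n) :
  (msupp p `<=` d)%fset -> nceval p X = \sum_(w <- d) p@_w *: ncword X w.
Proof.
move=> pd; rewrite /nceval (big_fset_incl _ pd) //= => w _ wp.
by rewrite mcoeff_outdom ?scale0r.
Qed.

Lemma nceval0 n (X : nctuple C g n) : nceval 0 X = 0.
Proof. by rewrite /nceval msupp0 big_seq_fset0. Qed.

Lemma ncevalD p q n (X : nctuple C g n) :
  nceval (p + q) X = nceval p X + nceval q X.
Proof.
pose d := (msupp p `|` msupp q)%fset.
rewrite !(@nceval_supp d) ?msuppD_le ?fsubsetUl ?fsubsetUr // -big_split /=.
by apply: eq_bigr => w _; rewrite mcoeffD scalerDl.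
Qed.

Lemma ncevalU a (w : {fmonom 'I_g}) n (X : nctuple C g n) :
  nceval << a *g w >> X = a *: ncword X w.
Proof. by rewrite (nceval_supp _ msuppU_le) big_seq_fset1 mcoeffUU. Qed.

Lemma ncevalZ a p n (X : nctuple C g n) : nceval (a *: p) X = a *: nceval p X.
Proof.
rewrite (nceval_supp _ (msuppZ_le _ _)) scaler_sumr.
by apply: eq_bigr => w _; rewrite mcoeffZ scalerA.
Qed.

Lemma nceval1 n (X : nctuple C g n) :
  nceval << 1 *g FMonom [::] >> X = 1%:M.
Proof. by rewrite ncevalU /ncword big_nil scale1r. Qed.

Definition ncpoly_mulX (h : 'I_g) p : ncpoly C g :=
  \sum_(w <- msupp p) << p@_w *g FMonom (h :: w) >>.

Lemma nceval_mulX h p n (X : nctuple C g n) :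
  nceval (ncpoly_mulX h p) X = X h *m nceval p X.
Proof.
rewrite /ncpoly_mulX (big_morph (fun q => nceval q X)
  (fun p q => ncevalD p q X) (nceval0 X)) mulmx_sumr.
by apply: eq_bigr => w _; rewrite ncevalU /ncword big_cons scalemxAr.
Qed.

(** Homomorphisms of modules over the free algebra. T acts on columns from the
    left, so a map from X to Y is an n-by-m matrix. *)
Definition nchom m n (X : nctuple C g m) (Y : nctuple C g n)
    (T : 'M[C]_(n, m)) : Prop :=
  forall h, T *m X h = Y h *m T.

Lemma nchom_comp m n k (X : nctuple C g m) (Y : nctuple C g n)
    (Z : nctuple C g k) T U :
  nchom X Y T -> nchom Y Z U -> nchom X Z (U *m T).
Proof. by move=> XY YZ h; rewrite -mulmxA XY !mulmxA YZ. Qed.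

Lemma nceval_hom p m n (X : nctuple C g m) (Y : nctuple C g n) T :
  nchom X Y T -> T *m nceval p X = nceval p Y *m T.
Proof.
move=> XY; rewrite /nceval mulmx_sumr mulmx_suml.
apply: eq_bigr => w _; rewrite -scalemxAr -scalemxAl; congr (_ *: _).
elim: (w : seq _) => [|h v IH]; first by rewrite !big_nil mulmx1 mul1mx.
by rewrite !big_cons mulmxA XY -!mulmxA IH.
Qed.

Lemma nchom_inl m n (X : nctuple C g m) (Y : nctuple C g n) :
  nchom X (ncdsum X Y) (col_mx 1%:M 0).
Proof.
by move=> h; rewrite ffunE mul_block_col mul_col_mx !mul0mx !mulmx0 !addr0
  mul1mx mulmx1.
Qed.

Lemma nchom_inr m n (X : nctuple C g m) (Y : nctuple C g n) :
  nchom Y (ncdsum X Y) (col_mx 0 1%:M).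
Proof.
by move=> h; rewrite ffunE mul_block_col mul_col_mx !mul0mx !mulmx0 !add0r
  mul1mx mulmx1.
Qed.

Lemma nchom_projr m n (X : nctuple C g m) Z (Y : nctuple C g n) :
  nchom (ncblock X Z Y) Y (row_mx 0 1%:M).
Proof.
by move=> h; rewrite ffunE mul_row_block mul_mx_row !mul0mx !mulmx0 !add0r
  mul1mx mulmx1.
Qed.

Lemma nchom_projl m n (X : nctuple C g m) (Y : nctuple C g n) :
  nchom (ncdsum X Y) X (row_mx 1%:M 0).
Proof.
by move=> h; rewrite ffunE mul_row_block mul_mx_row !mul0mx !mulmx0 !addr0
  mul1mx mulmx1.
Qed.

(** Compatibility with the two inclusions into a direct sum determines the value
    at the direct sum, and S itself is a homomorphism from X to S X S^-1. *)
Lemma nc_function_nceval p : nc_function setT (nceval p).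
Proof.
split=> [m n X Y _ _|n X S Su _ _].
  have := nceval_hom p (nchom_inr X Y).
  have := nceval_hom p (nchom_inl X Y).
  rewrite -[nceval p (ncdsum X Y)]submxK !mul_block_col !mul_col_mx.
  rewrite !mulmx0 !mulmx1 !mul1mx !mul0mx ?addr0 ?add0r.
  by move=> /eq_col_mx[<- <-] /eq_col_mx[<- <-].
rewrite [S *m _](@nceval_hom p _ _ X (ncconj S X)) ?mulmxK //.
by move=> h; rewrite ffunE mulmxKV.
Qed.

(** Since T X_h = Y_h T, the direct sum of Y and X is fixed under conjugation by
    the shear with off-diagonal block T. Hence f(Y) (+) f(X) commutes with this
    shear, which gives T f(X) = f(Y) T in the upper right corner. *)
Lemma nc_function_hom (Omega : set (ncspace C g))
    (f : forall n, nctuple C g n -> 'M[C]_n) :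
  nc_set Omega -> nc_function Omega f ->
  forall m n (X : nctuple C g m) (Y : nctuple C g n) T,
  Omega (ncpt X) -> Omega (ncpt Y) -> nchom X Y T -> T *m f _ X = f _ Y *m T.
Proof.
move=> Onc [f_sum f_conj] m n X Y T OX OY XY.
pose U : 'M[C]_(n + m) := block_mx 1%:M T 0 1%:M.
have UU : U \in unitmx.
  by rewrite unitmxE det_ublock !det1 mulr1 unitr1.
have cU : ncconj U (ncdsum Y X) = ncdsum Y X.
  apply/ffunP => h; rewrite !ffunE; apply: (canLR (mulmxK UU)).
  by rewrite !mulmx_block !(mul1mx, mulmx1, mul0mx, mulmx0, addr0, add0r) XY.
have OS := Onc _ _ _ _ OY OX.
have := f_conj _ _ _ UU OS; rewrite cU => /(_ OS) /(canLR (mulmxKV UU)).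
rewrite f_sum // !mulmx_block !(mul1mx, mulmx1, mul0mx, mulmx0, addr0, add0r).
by move=> /eq_block_mx[].
Qed.

(** * Quotients *)

Definition ncquotient m n (X : nctuple C g m) (Y : nctuple C g n) : Prop :=
  exists (q : 'M[C]_(n, m)) (k : 'M[C]_(m, n)), nchom X Y q /\ q *m k = 1%:M.

Lemma ncquotient_refl n (X : nctuple C g n) : ncquotient X X.
Proof.
by exists 1%:M, 1%:M; rewrite mulmx1; split=> // h; rewrite mul1mx mulmx1.
Qed.

Lemma ncquotient_trans m n k (X : nctuple C g m) (Y : nctuple C g n)
    (Z : nctuple C g k) :
  ncquotient X Y -> ncquotient Y Z -> ncquotient X Z.
Proof.
move=> [q [a [qH qa]]] [r [b [rH rb]]]; exists (r *m q), (a *m b).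
split; first exact: nchom_comp qH rH.
by rewrite mulmxA -(mulmxA r) qa mulmx1.
Qed.

Lemma ncquotient_dsuml m n (X : nctuple C g m) (Y : nctuple C g n) :
  ncquotient (ncdsum X Y) X.
Proof.
exists (row_mx 1%:M 0), (col_mx 1%:M 0); split; first exact: nchom_projl.
by rewrite mul_row_col mul1mx mul0mx addr0.
Qed.

Lemma ncquotient_blockr m n (X : nctuple C g m) Z (Y : nctuple C g n) :
  ncquotient (ncblock X Z Y) Y.
Proof.
exists (row_mx 0 1%:M), (col_mx 0 1%:M); split; first exact: nchom_projr.
by rewrite mul_row_col mul1mx mul0mx add0r.
Qed.

(** * Bidiagonal points as iterated extensions *)

(** The size of a bidiagonal point is a big sum, which is equal but not
    convertible to the sizes of points built by [ncblock]. Equality of points of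
    the nc space absorbs the casts. *)
Lemma ncpt_transport (P : forall n, nctuple C g n -> Prop) m n
    (X : nctuple C g m) (Y : nctuple C g n) :
  ncpt X = ncpt Y -> P _ Y -> P _ X.
Proof.
move=> XY; pose Q (a : ncspace C g) := P (tag a) (tagged a).
by have : Q (ncpt Y) -> Q (ncpt X) by rewrite XY.
Qed.

Lemma ncpt_castmx m n (e : m = n) (X : nctuple C g m) (Y : nctuple C g n) :
  (forall h, Y h = castmx (e, e) (X h)) -> ncpt Y = ncpt X.
Proof.
case: n / e Y => Y YX; suff -> : Y = X by [].
by apply/ffunP => h; rewrite YX castmx_id.
Qed.

Lemma ncbidiag0 s (Y : nctuple C g s) (Z : 'I_0 -> nctuple C g s) :
  ncpt (ncbidiag Y Z) = ncpt Y.
Proof.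
have e : s = (\sum_(i < 1) s)%N by rewrite big_ord1.
apply: (@ncpt_castmx _ _ e) => h.
rewrite [in RHS](mxEmxblock (Y h)) castmx_comp castmx_id ffunE.
by apply/eq_mxblock => i j; rewrite !ord1.
Qed.

(** The first block row of a bidiagonal point, without its diagonal block. *)
Definition ncbidiag_row s l (Z : nctuple C g s) (h : 'I_g) :
    'M[C]_(s, \sum_(i < l.+1) s) :=
  \mxrow_(j < l.+1) (if j == ord0 then Z h else 0).

Lemma ncbidiagS s (Y : nctuple C g s) l (Z : 'I_l.+1 -> nctuple C g s) :
  ncpt (ncbidiag Y Z) =
  ncpt (ncblock Y (ncbidiag_row l (Z ord0))
    (ncbidiag Y (fun k => Z (lift ord0 k)))).
Proof.
apply: ncpt_castmx => [|e h]; first by rewrite [RHS]big_ord_recl.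
rewrite !ffunE mxblock_recul (eq_castmx _ (e, e)).
congr (castmx (e, e) (block_mx _ _ _ _)).
- apply: eq_mxrow => j; rewrite liftK.
  have [->|j0] := eqVneq j ord0; first by rewrite eqxx.
  by rewrite eq_sym [_ == _](negPf j0).
- by rewrite -[RHS]mxcol0; apply: eq_mxcol => i; rewrite unlift_none.
- apply: eq_mxblock => i j; rewrite (inj_eq lift_inj) liftK.
  case: eqP => // _; case: unliftP => [k ->|->] /=; last by [].
  by rewrite /bump /= !add1n eqSS.
Qed.

Definition ncrescale s l (a : 'I_l -> C) (Z : 'I_l -> nctuple C g s)
  (k : 'I_l) : nctuple C g s := [ffun h => a k *: Z k h].

Section AdmissibleSet.
Variable Omega : set (ncspace C g).
Hypotheses (Omega_nc : nc_set Omega) (Omega_adm : admissible Omega).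

(** * Hereditary points *)

(** Retracts let f reach modules that are not points of Omega: such a module V
    occurs as the image of an idempotent endomorphism of a point N. *)
Definition ncretract m (V : nctuple C g m) : Prop :=
  exists n (N : nctuple C g n) (i : 'M[C]_(n, m)) (r : 'M[C]_(m, n)),
    [/\ Omega (ncpt N), nchom V N i, nchom N V r & r *m i = 1%:M].

(** A submodule is given by a basis, the columns of j; the left inverse k of j
    expresses that they are independent. *)
Definition hereditary n (X : nctuple C g n) : Prop :=
  Omega (ncpt X) /\
  forall m (V : nctuple C g m) (j : 'M[C]_(n, m)) (k : 'M[C]_(m, n)),
    nchom V X j -> k *m j = 1%:M -> ncretract V.

(** Let K and Q be retracts of N1 and N2. In the splitting of V given by a' and
    b', V is the block upper triangular module with diagonal K, Q and corner
    Z = a' V b'. Pushing Z along i1 and pulling it back along r2 gives an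
    extension of N2 by N1 that retracts onto V, block by block. Scaling its
    corner by c, as admissibility requires, is undone by scaling the N2
    component by c^-1. *)
Lemma ncretract_ext m k l (V : nctuple C g m) (K : nctuple C g k)
    (Q : nctuple C g l) (a : 'M[C]_(m, k)) (b : 'M[C]_(l, m))
    (a' : 'M[C]_(k, m)) (b' : 'M[C]_(m, l)) :
  nchom K V a -> nchom V Q b ->
  a' *m a = 1%:M -> b *m b' = 1%:M -> a *m a' + b' *m b = 1%:M ->
  ncretract K -> ncretract Q -> ncretract V.
Proof.
move=> aH bH a'a bb' ab1 [n1 [N1 [i1 [r1 [O1 i1H r1H ri1]]]]].
move=> [n2 [N2 [i2 [r2 [O2 i2H r2H ri2]]]]].
pose Z (h : 'I_g) := a' *m V h *m b'.
have [c c0 ON] := Omega_adm (fun h => i1 *m Z h *m r2) O1 O2.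
have a'V h : a' *m V h = K h *m a' + Z h *m b.
  by rewrite -[a' *m V h]mulmx1 -ab1 mulmxDr /Z !mulmxA -(mulmxA a') -aH
    mulmxA a'a mul1mx.
have Vb' h : V h *m b' = a *m Z h + b' *m Q h.
  rewrite -[V h *m b']mul1mx -ab1 mulmxDl /Z !mulmxA; congr (_ + _).
  by rewrite -(mulmxA b') bH -!mulmxA bb' mulmx1.
exists _, (ncblock N1 (fun h => c *: (i1 *m Z h *m r2)) N2),
  (col_mx (i1 *m a') (c^-1 *: (i2 *m b))),
  (row_mx (a *m r1) (c *: (b' *m r2))); split; first exact: ON.
- move=> h; rewrite ffunE mul_col_mx mul_block_col mul0mx add0r.
  congr col_mx; last first.
    by rewrite -scalemxAl -scalemxAr -!mulmxA bH !mulmxA i2H.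
  rewrite -mulmxA a'V mulmxDr !mulmxA i1H; congr (_ + _).
  rewrite -scalemxAl -scalemxAr scalerA divff // scale1r.
  by rewrite !mulmxA -(mulmxA _ r2) ri2 mulmx1.
- move=> h; rewrite ffunE mul_row_block mul_mx_row mulmx0 addr0.
  congr row_mx; first by rewrite -mulmxA r1H !mulmxA aH.
  rewrite -!scalemxAr -scalemxAl -scalerDr; congr (_ *: _).
  rewrite [RHS]mulmxA Vb' mulmxDl -!mulmxA r2H.
  by rewrite !mulmxA -(mulmxA a) ri1 mulmx1.
- rewrite mul_row_col !mulmxA -(mulmxA a) ri1 mulmx1.
  rewrite -scalemxAr -scalemxAl scalerA mulVf // scale1r.
  by rewrite !mulmxA -(mulmxA b') ri2 mulmx1.
Qed.

(** A submodule V of an extension of B by A meets A in a submodule K of A, and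
    its image Q in B is a submodule of B. So V is an extension of the retract Q
    by the retract K. In coordinates, K is the kernel and Q the image of the
    lower block of the embedding j of V. *)
Lemma hereditary_ext m n (A : nctuple C g m) (B : nctuple C g n) Z :
  hereditary A -> hereditary B -> Omega (ncpt (ncblock A Z B)) ->
  hereditary (ncblock A Z B).
Proof.
move=> [OA hA] [OB hB] OE; split=> // v V j k jH kj.
have [l [b [d [c [d' [dE cb dd']]]]]] := rank_factorization (dsubmx j).
(* e projects V onto the kernel of the map to B. *)
pose e := 1%:M - d' *m d.
have ee : e *m e = e.
  rewrite /e mulmxBl mul1mx mulmxBr mulmx1 -mulmxA (mulmxA d) dd' mul1mx.
  by rewrite subrr subr0.
have [r [a [a' [eE a'a]]]] := idempotent_splitting ee.
have da : d *m a = 0.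
  have : d *m e *m a = 0.
    by rewrite /e mulmxBr mulmxA dd' mul1mx mulmx1 subrr mul0mx.
  by rewrite eE -mulmxA -mulmxA a'a mulmx1.
have ad : a *m a' + d' *m d = 1%:M by rewrite -eE /e subrK.
have djH h : dsubmx j *m V h = B h *m dsubmx j.
  have := jH h; rewrite -{1 2}[j]vsubmxK ffunE mul_col_mx mul_block_col.
  by rewrite mul0mx add0r => /eq_col_mx[].
have bH0 h : d *m V h = (c *m B h *m b) *m d.
  by rewrite -!mulmxA -dE -djH dE !mulmxA cb mul1mx.
pose K : nctuple C g r := [ffun h => a' *m V h *m a].
pose Q : nctuple C g l := [ffun h => c *m B h *m b].
have dH : nchom V Q d by move=> h; rewrite ffunE bH0.
have aH : nchom K V a.
  move=> h; rewrite ffunE !mulmxA.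
  have -> : a *m a' = 1%:M - d' *m d by rewrite -ad addrK.
  rewrite mulmxBl mul1mx mulmxBl -(mulmxA d') bH0.
  by rewrite -!mulmxA da !mulmx0 subr0.
apply: (ncretract_ext aH dH a'a dd' ad).
  apply: (hA _ K (usubmx j *m a) (a' *m k *m col_mx 1%:M 0)).
    move=> h; have := nchom_comp aH jH h; rewrite !ffunE.
    have -> : j *m a = col_mx (usubmx j *m a) 0.
      by rewrite -{1}[j]vsubmxK mul_col_mx dE -mulmxA da mulmx0.
    rewrite mul_col_mx mul_block_col !mulmx0 !mul0mx !addr0.
    by move=> /eq_col_mx[].
  have ja : j *m a = col_mx 1%:M 0 *m (usubmx j *m a).
    rewrite -[in LHS](vsubmxK j) mul_col_mx dE -mulmxA da mulmx0.
    by rewrite mul_col_mx mul1mx mul0mx.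
  by rewrite -!mulmxA -ja mulmxA -(mulmxA a') (mulmxA k) kj mul1mx.
apply: (hB _ Q b c) => // h; rewrite ffunE.
rewrite -[X in b *m X]mulmx1 -dd' (mulmxA _ d) -bH0 !mulmxA -dE djH dE.
by rewrite -!mulmxA dd' mulmx1.
Qed.

(** The projection P onto a submodule U along an invariant complement is an
    endomorphism of Y, so U is a retract of Y itself. *)
Lemma hereditary_semisimple s (Y : nctuple C g s) :
  Omega (ncpt Y) -> semisimple Y -> hereditary Y.
Proof.
move=> OY ssY; split=> // m V j k jH kj.
pose U : {vspace 'cV[C]_s} := limg (linfun (mulmx j)).
have UP v : reflect (exists y, v = j *m y) (v \in U).
  apply: (iffP memv_imgP) => [[y _ ->]|[y ->]]; exists y.
  - by rewrite lfunE.
  - exact: memvf.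
  - by rewrite lfunE.
have UY : Defs.invariant Y U.
  by move=> h _ /UP[y ->]; apply/UP; exists (V h *m y); rewrite !mulmxA jH.
have [W [WY UW1 UW0]] := ssY U UY.
have [P PE0] := linear_colmx (daddv_pi U W).
have PE v : P *m v = daddv_pi U W v by exact: PE0.
have PU v : v \in U -> P *m v = v.
  by move=> vU; rewrite PE; apply: daddv_pi_id.
have PW v : v \in W -> P *m v = 0.
  move=> vW; apply: (addIr v); rewrite add0r PE.
  rewrite -{2}(@daddv_pi_id _ _ W U v) ?[(W :&: U)%VS]capvC //.
  by apply: daddv_pi_add; rewrite // UW1 memvf.
have PY h : P *m Y h = Y h *m P.
  apply: mulmx_ext => v; have : v \in (U + W)%VS by rewrite UW1 memvf.
  move=> /memv_addP[u uU [w wW ->]]; rewrite -!mulmxA !mulmxDr.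
  by rewrite (PU _ uU) (PW _ wW) (PU _ (UY h _ uU)) (PW _ (WY h _ wW)) mulmx0.
have jkP : j *m k *m P = P.
  apply: mulmx_ext => v; rewrite -!mulmxA PE.
  have /UP[y ->] := memv_pi U W v.
  by rewrite !mulmxA -(mulmxA j) kj mulmx1.
exists s, Y, j, (k *m P); split=> // [h|].
  by rewrite -mulmxA PY -{1}jkP !mulmxA -(mulmxA k) -jH mulmxA kj mul1mx.
rewrite -mulmxA (_ : P *m j = j) //; apply: mulmx_ext => v.
by rewrite -mulmxA PU //; apply/UP; exists v.
Qed.

Lemma ncblock_hereditary m n (A : nctuple C g m) (B : nctuple C g n) Z :
  hereditary A -> hereditary B ->
  exists2 c, c != 0 & hereditary (ncblock A (fun h => c *: Z h) B).
Proof.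
move=> hA hB; have [c c0 OZ] := Omega_adm Z hA.1 hB.1.
by exists c => //; apply: hereditary_ext.
Qed.

Lemma ncdsum_hereditary m n (A : nctuple C g m) (B : nctuple C g n) :
  hereditary A -> hereditary B -> hereditary (ncdsum A B).
Proof.
by move=> hA hB; apply: (hereditary_ext hA hB); apply: Omega_nc hA.1 hB.1.
Qed.

(** * Polynomial values at hereditary points *)

Section NCFunction.
Variable f : forall n, nctuple C g n -> 'M[C]_n.
Hypothesis f_nc : nc_function Omega f.

(** The polynomials applied to u fill a submodule V, with embedding j. Let V be
    a retract of N through i and r. Then j r is a homomorphism from N to H,
    hence f(H) j = f(H) j r i = j (r f(N) i), so f(H) maps V into V. *)
Lemma nc_function_cyclic n (H : nctuple C g n) (u : 'cV[C]_n) :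
  hereditary H -> exists p : ncpoly C g, f H *m u = nceval p H *m u.
Proof.
move=> [OH hH]; pose P v := exists p : ncpoly C g, v = nceval p H *m u.
have PX h v : P v -> P (H h *m v).
  by move=> [p ->]; exists (ncpoly_mulX h p); rewrite nceval_mulX mulmxA.
have [|||m [j [k [kj Pj]]]] := @subspace_basis _ _ P.
- by exists 0; rewrite nceval0 mul0mx.
- by move=> _ _ [p ->] [q ->]; exists (p + q); rewrite ncevalD mulmxDl.
- by move=> a _ [p ->]; exists (a *: p); rewrite ncevalZ scalemxAl.
have Pim y : P (j *m y) by apply/Pj; rewrite (mulmxA k) kj mul1mx.
pose V : nctuple C g m := [ffun h => k *m H h *m j].
have jH : nchom V H j.
  move=> h; rewrite ffunE; apply: mulmx_ext => y; rewrite -!mulmxA.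
  by apply/esym/Pj/PX.
have [n' [N [i [r [ON iH rH ri]]]]] := hH _ V j k jH kj.
have uE : u = j *m (k *m u).
  by apply/Pj; exists << 1 *g FMonom [::] >>; rewrite nceval1 mul1mx.
have fj := nc_function_hom Omega_nc f_nc ON OH (nchom_comp rH jH).
have : P (f H *m u); last by [].
rewrite uE mulmxA -[j in f H *m j]mulmx1 -ri !mulmxA -(mulmxA _ j) -fj.
by rewrite -!mulmxA; apply: Pim.
Qed.

(** In the direct sum H of copies of G, a single vector u projects onto all the
    given vectors: a polynomial fitting f at u fits f at each of them. The base
    case is G rather than the zero module, whose point need not lie in Omega. *)
Lemma hereditary_power n (G : nctuple C g n) (vs : seq 'cV[C]_n) :
  hereditary G -> exists m (H : nctuple C g m) (u : 'cV[C]_m),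
    hereditary H /\
    forall v, v \in vs -> exists2 T, nchom H G T & T *m u = v.
Proof.
move=> hG; elim: vs => [|v vs [m [H [u [hH IH]]]]]; first by exists n, G, 0.
exists _, (ncdsum G H), (col_mx v u); split; first exact: ncdsum_hereditary.
move=> w; rewrite inE => /predU1P[->|/IH[T TH TE]].
  exists (row_mx 1%:M 0); first exact: nchom_projl.
  by rewrite mul_row_col mul1mx mul0mx addr0.
exists (T *m row_mx 0 1%:M); first exact: nchom_comp (nchom_projr _ _ _) TH.
by rewrite -mulmxA mul_row_col mul1mx mul0mx add0r.
Qed.

Lemma nc_function_nceval_at n (G : nctuple C g n) :
  hereditary G -> exists p : ncpoly C g, f G = nceval p G.
Proof.
move=> hG; pose vs := [seq delta_mx b 0 : 'cV[C]_n | b <- enum 'I_n].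
have [m [H [u [hH HG]]]] := hereditary_power vs hG.
have [p fp] := nc_function_cyclic u hH.
exists p; apply/matrixP => a b.
have [|T TH TE] := HG (delta_mx b 0).
  by apply/mapP; exists b; rewrite ?mem_enum.
pose e : 'cV[C]_n := delta_mx b 0.
suff : f G *m e = nceval p G *m e.
  by rewrite -!colE => /matrixP/(_ a 0); rewrite !mxE.
rewrite /e -TE !mulmxA -(nceval_hom p TH).
by rewrite -(nc_function_hom Omega_nc f_nc hH.1 hG.1 TH) -!mulmxA fp.
Qed.

End NCFunction.

(** * Points with all bidiagonal points as quotients *)

(** A matrix t with t G = Y t + Z q trivializes the pullback along q of the
    extension of A by Y with corner Z. Each step adjoins a copy of Y that
    trivializes the pullback for one more Z. *)
Lemma universal_extension_seq n s (A : nctuple C g n) (Y : nctuple C g s)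
    (Zs : seq {ffun 'I_g -> 'M[C]_(s, n)}) :
  hereditary A -> hereditary Y ->
  exists m (G : nctuple C g m) (q : 'M[C]_(n, m)) (k : 'M[C]_(m, n)),
    [/\ hereditary G, nchom G A q, q *m k = 1%:M &
      forall Z, Z \in Zs -> exists t : 'M[C]_(s, m),
        forall h, t *m G h = Y h *m t + Z h *m q].
Proof.
move=> hA hY; elim: Zs => [|Z0 Zs [m [G [q [k [hG qH qk IH]]]]]].
  exists n, A, 1%:M, 1%:M; rewrite mulmx1; split=> // h.
  by rewrite mul1mx mulmx1.
have [c c0 hE] := ncblock_hereditary (fun h => Z0 h *m q) hY hG.
exists _, (ncblock Y (fun h => c *: (Z0 h *m q)) G), (row_mx 0 q),
  (col_mx 0 k); split=> // [h| |Z].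
- rewrite ffunE mul_row_block mul_mx_row !mul0mx !mulmx0 !add0r.
  by rewrite (qH h).
- by rewrite mul_row_col mul0mx add0r.
rewrite inE => /predU1P[->|/IH[t tE]].
  (* The copy of Y just added sees the corner c (Z0 q). *)
  exists (row_mx c^-1%:M 0) => h.
  rewrite ffunE mul_row_block !mul_mx_row add_row_mx.
  rewrite !mul0mx !mulmx0 !addr0 add0r !mul_scalar_mx mul_mx_scalar.
  by rewrite scalerA mulVf // scale1r.
exists (row_mx 0 t) => h.
by rewrite ffunE mul_row_block !mul_mx_row add_row_mx !mul0mx !mulmx0 !add0r tE.
Qed.

(** The Z for which t exists form a subspace, so it is enough to treat a basis.
    With t at hand, (t, q) maps G to the extension with corner Z, and a further
    summand Y makes this map surjective. A corner over a quotient B of A is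
    first pulled back to A. *)
Lemma universal_extension n s (A : nctuple C g n) (Y : nctuple C g s) :
  hereditary A -> hereditary Y ->
  exists m (G : nctuple C g m),
    [/\ hereditary G, ncquotient G A &
      forall n' (B : nctuple C g n') (Z : 'I_g -> 'M[C]_(s, n')),
        ncquotient A B -> ncquotient G (ncblock Y Z B)].
Proof.
move=> hA hY.
pose E := vbasis (fullv : {vspace {ffun 'I_g -> 'M[C]_(s, n)}}).
have [m [G [q [k [hG qH qk GE]]]]] := universal_extension_seq E hA hY.
have {GE} GE (Z : {ffun 'I_g -> 'M[C]_(s, n)}) :
    exists t : 'M[C]_(s, m), forall h, t *m G h = Y h *m t + Z h *m q.
  pose K (Z' : {ffun 'I_g -> 'M[C]_(s, n)}) :=
    exists t : 'M[C]_(s, m), forall h, t *m G h = Y h *m t + Z' h *m q.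
  rewrite -/(K Z) (coord_vbasis (memvf Z)).
  apply: (big_ind K) => [|Z1 Z2|i _].
  - by exists 0 => h; rewrite !mul0mx mulmx0 ffunE mul0mx addr0.
  - move=> [t1 E1] [t2 E2]; exists (t1 + t2) => h.
    by rewrite ffunE !mulmxDl mulmxDr E1 E2 addrACA.
  have [|t tE] := GE E`_i; first by rewrite mem_nth // size_tuple.
  exists (coord E i Z *: t) => h.
  by rewrite ffunE -!scalemxAl tE scalerDr scalemxAr.
exists _, (ncdsum Y G); split; first exact: ncdsum_hereditary.
  by apply: ncquotient_trans (ncquotient_blockr _ _ _) _; exists q, k.
move=> n' B Z [r [l [rH rl]]].
have [t tE] := GE [ffun h => Z h *m r].
exists (block_mx 1%:M t 0 (r *m q)),
  (block_mx 1%:M (- t *m (k *m l)) 0 (k *m l)).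
split=> [h|].
  rewrite !ffunE !mulmx_block !(mul1mx, mulmx1, mul0mx, mulmx0, addr0, add0r).
  by rewrite tE ffunE -[r *m q *m G h]mulmxA qH !mulmxA rH.
rewrite mulmx_block !(mul1mx, mulmx1, mul0mx, mulmx0, addr0, add0r).
by rewrite mulNmx addNr -(mulmxA r) (mulmxA q) qk mul1mx rl -scalar_mx_block.
Qed.

(** By induction on L: removing the first block of a bidiagonal point presents
    it as an extension of a shorter one by Y. *)
Lemma universal_bidiag s (Y : nctuple C g s) L :
  hereditary Y ->
  exists m (G : nctuple C g m), hereditary G /\
    forall l (Z : 'I_l -> nctuple C g s), (l <= L)%N ->
      ncquotient G (ncbidiag Y Z).
Proof.
move=> hY; elim: L => [|L [m [G [hG IH]]]].
  exists s, Y; split=> // l Z; rewrite leqn0 => /eqP l0; move: Z; rewrite l0.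
  move=> Z; apply: (ncpt_transport (P := fun n X => ncquotient Y X)).
    exact: ncbidiag0.
  exact: ncquotient_refl.
have [m' [G' [hG' G'G G'Y]]] := universal_extension hG hY.
exists m', G'; split=> // -[|l] Z lL.
  exact: ncquotient_trans G'G (IH _ _ _).
apply: (ncpt_transport (P := fun n X => ncquotient G' X)).
  exact: ncbidiagS.
by apply: G'Y; apply: IH.
Qed.

(** The point X starts the direct sum, as the zero module may lie outside
    Omega. *)
Lemma universal_bidiag_seq n (X : nctuple C g n) (Ys : seq (ncspace C g)) L :
  hereditary X -> (forall Y, Y \in Ys -> hereditary (tagged Y)) ->
  exists m (G : nctuple C g m), hereditary G /\
    forall s (Y : nctuple C g s), ncpt Y \in Ys ->
    forall l (Z : 'I_l -> nctuple C g s), (l <= L)%N ->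
      ncquotient G (ncbidiag Y Z).
Proof.
move=> hX; elim: Ys => [_|[s0 Y0] Ys IH hYs]; first by exists n, X.
have [m0 [G0 [hG0 G0Y]]] := universal_bidiag L (hYs (ncpt Y0) (mem_head _ _)).
have [|m [G [hG GY]]] := IH.
  by move=> Y YYs; apply: hYs; rewrite inE YYs orbT.
exists _, (ncdsum G0 G); split; first exact: ncdsum_hereditary.
move=> s Y; rewrite inE => /predU1P[YE|YYs] l Z lL; last first.
  exact: ncquotient_trans (ncquotient_blockr _ _ _) (GY _ _ YYs _ _ lL).
pose P t (T : nctuple C g t) := forall Z' : 'I_l -> nctuple C g t,
  ncquotient (ncdsum G0 G) (ncbidiag T Z').
apply: (ncpt_transport (P := P) YE) => Z'.
exact: ncquotient_trans (ncquotient_dsuml _ _) (G0Y _ _ lL).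
Qed.

(** * Interpolation of differentials *)

(** The scalars are found block by block; the one for the first block row is
    supplied by admissibility once the remaining point lies in Omega. *)
Lemma admissible_bidiag s (Y : nctuple C g s) l (Z : 'I_l -> nctuple C g s) :
  Omega (ncpt Y) ->
  exists a : 'I_l -> C, (forall k, a k != 0) /\
    Omega (ncpt (ncbidiag Y (ncrescale a Z))).
Proof.
move=> OY; elim: l Z => [|l IH] Z.
  by exists (fun=> 1); split=> [_|]; rewrite ?oner_neq0 // ncbidiag0.
have [a [a0 OB]] := IH (fun k => Z (lift ord0 k)).
have [c c0 OE] := Omega_adm (ncbidiag_row l (Z ord0)) OY OB.
exists (fun k => if unlift ord0 k is Some k' then a k' else c).
split=> [k|]; first by case: unliftP => [k'|] _.
rewrite ncbidiagS; congr (Omega (ncpt _)): OE.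
apply/ffunP => h; rewrite !ffunE; congr block_mx.
  apply/matrixP => u v; rewrite !mxE.
  by case: eqP => _; rewrite ?ffunE ?unlift_none !mxE ?mulr0.
by apply: eq_mxblock => i j; case: eqP => // _; case: unlift => // k;
  case: eqP => // _; rewrite !ffunE liftK.
Qed.

Lemma ncdiff_rescale (f : forall n, nctuple C g n -> 'M[C]_n)
    s (Y : nctuple C g s) l (Z : 'I_l -> nctuple C g s) (a : 'I_l -> C) :
  nc_function Omega f -> (forall k, a k != 0) ->
  Omega (ncpt (ncbidiag Y (ncrescale a Z))) ->
  ncdiff Omega f Y Z = (\prod_k a k)^-1 *:
    submxblock (f _ (ncbidiag Y (ncrescale a Z))) ord0 ord_max.
Proof.
move=> f_nc a0 Oa; apply: xget_unique => [|_ [b [b0 Ob ->]]]; first by exists a.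
exact: (ncdiff_uniq f_nc).
Qed.

End AdmissibleSet.

Lemma nc_interpolation (Omega : set (ncspace C g))
    (f : forall n, nctuple C g n -> 'M[C]_n) (S : set (ncspace C g)) (L : nat) :
  nc_set Omega -> admissible Omega -> nc_function Omega f ->
  finite_set S -> S `<=` Omega ->
  (forall s (Y : nctuple C g s), S (ncpt Y) -> semisimple Y) ->
  exists p : ncpoly C g,
    forall s (Y : nctuple C g s), S (ncpt Y) ->
    forall l, (l <= L)%N -> forall Z : 'I_l -> nctuple C g s,
      ncdiff Omega f Y Z = ncdiff setT (nceval p) Y Z.
Proof.
move=> Omega_nc Omega_adm f_nc /finite_seqP[Ys ->] SO Sss.
have hYs Y : Y \in Ys -> hereditary Omega (tagged Y).
  by case: Y => s Y YS; apply: hereditary_semisimple; [apply: SO|apply: Sss].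
case YsE: Ys => [|X Xs]; first by exists 0.
rewrite -YsE.
have hX : hereditary Omega (tagged X) by apply: hYs; rewrite YsE mem_head.
have [m [G [hG GY]]] := universal_bidiag_seq Omega_nc Omega_adm L hX hYs.
have [p fp] := nc_function_nceval_at Omega_nc Omega_adm f_nc hG.
exists p => s Y YS l lL Z.
have [a [a0 Oa]] := admissible_bidiag Omega_adm Z (SO _ YS).
rewrite (ncdiff_rescale f_nc a0 Oa).
rewrite (ncdiff_rescale (nc_function_nceval p) a0) //.
have [q [k [qH qk]]] := GY _ _ YS _ (ncrescale a Z) lL.
congr (_ *: submxblock _ _ _).
rewrite -[LHS]mulmx1 -[RHS]mulmx1 -qk !mulmxA -(nceval_hom p qH) -fp.
by rewrite (nc_function_hom Omega_nc f_nc hG.1 Oa qH).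
Qed.

End Interpolation.

Theorem theorem4 (R : realType) (g : nat)
    (Omega : set (ncspace R[i] g))
    (f : forall n, nctuple R[i] g n -> 'M[R[i]]_n)
    (S : set (ncspace R[i] g)) (L : nat)
    (Omega_nc : nc_set Omega) (Omega_adm : admissible Omega)
    (f_nc : nc_function Omega f)
    (S_fin : finite_set S) (S_sub : S `<=` Omega)
    (S_ss : forall s (Y : nctuple R[i] g s), S (ncpt Y) -> semisimple Y) :
  exists p : ncpoly R[i] g,
    forall s (Y : nctuple R[i] g s), S (ncpt Y) ->
    forall l : nat, (l <= L)%N ->
    forall Z : 'I_l -> nctuple R[i] g s,
      ncdiff Omega f Y Z = ncdiff setT (nceval p) Y Z.
Proof. exact: nc_interpolation. Qed.
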